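(* Let $p$ be an odd prime, let $d$ be the multiplicative order of $2$ modulo $p$, and let $G$ be the dihedral group $D_{2p} = \langle a, b \mid a^p = 1,\ b^2 = 1,\ b^{-1}ab = a^{-1}\rangle$. Let $V = \langle 1 + \widehat{D_{2p}}\rangle$ be the subgroup of $\mathcal{U}(F_2D_{2p})$ generated by $1+\widehat{D_{2p}}$, where $\widehat{D_{2p}}$ denotes the sum of all elements of $D_{2p}$. Then $$\mathcal{U}(F_2D_{2p})/V \cong \begin{cases} \underbrace{GL_2(F_{2^{d/2}}) \times \cdots \times GL_2(F_{2^{d/2}})}_{\frac{\phi(p)}{d}\ \text{copies}}, & \text{if } d \text{ is even},\\[2ex] \underbrace{GL_2(F_{2^{d}}) \times \cdots \times GL_2(F_{2^{d}})}_{\frac{\phi(p)}{2d}\ \text{copies}}, & \text{if } d \text{ is odd},\end{cases}$$ and hence $$|\mathcal{U}(F_2D_{2p})| = \begin{cases} 2\left((2^d-1)(2^d-2^{d/2})\right)^{\frac{\phi(p)}{d}}, & \text{if } d \text{ is even},\\[1ex] 2\left((2^{2d}-1)(2^{2d}-2^{d})\right)^{\frac{\phi(p)}{2d}}, & \text{if } d \text{ is odd}.\end{cases}$$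
   Context: $F_q$ denotes the finite field with $q$ elements; $F_2D_{2p}$ is the group algebra of $D_{2p}$ over $F_2$ and $\mathcal{U}(F_2D_{2p})$ is its group of units. $\phi$ is Euler's totient function, so $\phi(p)=p-1$. $GL_2(F)$ is the group of invertible $2\times 2$ matrices over $F$. *)

(* Defs.v *)
From HB Require Import structures.
From mathcomp Require Import all_boot all_order all_fingroup all_algebra.
From mathcomp Require Import all_solvable.

Set Implicit Arguments.
Unset Strict Implicit.
Unset Printing Implicit Defensive.

Import GRing.Theory.
Local Open Scope ring_scope.

(* An element f stands for the formal sum \sum_g (f g) g.  This is an alias of *)
(* {ffun gT -> R} so that it does not inherit the pointwise multiplication.    *)
Definition group_algebra (R : nzRingType) (gT : finGroupType) : Type :=
  {ffun gT -> R}.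
Arguments group_algebra R gT%_type.

Section GroupAlgebra.

Variables (R : nzRingType) (gT : finGroupType).

HB.instance Definition _ :=
  GRing.Zmodule.copy (group_algebra R gT) {ffun gT -> R}.

Implicit Types (f g h : group_algebra R gT) (x y z : gT).

Definition galg_elt x : group_algebra R gT := [ffun y => (y == x)%:R].

Definition galg_mul f g : group_algebra R gT :=
  [ffun x => \sum_y f y * g (y^-1 * x)%g].

Fact galg_mulA : associative galg_mul.
Proof.
move=> f g h; apply/ffunP=> x; rewrite !ffunE.
under eq_bigr => y _ do rewrite ffunE big_distrr /=.
under [RHS]eq_bigr => z _ do rewrite ffunE big_distrl /=.
rewrite [RHS]exchange_big /=; apply: eq_bigr => y _.
rewrite [RHS](reindex_inj (mulgI y)) /=; apply: eq_bigr => z _.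
by rewrite mulrA mulKg invMg mulgA.
Qed.

Fact galg_mul1r : left_id (galg_elt 1%g) galg_mul.
Proof.
move=> f; apply/ffunP=> x; rewrite !ffunE (bigD1 1%g) //= ffunE eqxx mul1r.
rewrite invg1 mul1g big1 ?addr0 // => y /negPf ny1.
by rewrite ffunE ny1 mul0r.
Qed.

Fact galg_mulr1 : right_id (galg_elt 1%g) galg_mul.
Proof.
move=> f; apply/ffunP=> x; rewrite !ffunE (bigD1 x) //= ffunE mulVg eqxx mulr1.
rewrite big1 ?addr0 // => y nyx.
by rewrite ffunE -eq_mulVg1 (negPf nyx) mulr0.
Qed.

Fact galg_mulDl : left_distributive galg_mul +%R.
Proof.
move=> f g h; apply/ffunP=> x; rewrite !ffunE -big_split /=.
by apply: eq_bigr => y _; rewrite ffunE mulrDl.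
Qed.

Fact galg_mulDr : right_distributive galg_mul +%R.
Proof.
move=> f g h; apply/ffunP=> x; rewrite !ffunE -big_split /=.
by apply: eq_bigr => y _; rewrite ffunE mulrDr.
Qed.

Fact galg_oner_neq0 : galg_elt 1%g != 0.
Proof. by apply/eqP=> /ffunP/(_ 1%g)/eqP; rewrite !ffunE eqxx oner_eq0. Qed.

HB.instance Definition _ := GRing.Zmodule_isNzRing.Build (group_algebra R gT)
  galg_mulA galg_mul1r galg_mulr1 galg_mulDl galg_mulDr galg_oner_neq0.

Definition galg_sum : group_algebra R gT := \sum_(x : gT) galg_elt x.

Lemma galg_sumE : galg_sum = [ffun=> 1].
Proof.
apply/ffunP=> x; rewrite /galg_sum.
rewrite (@sum_ffunE gT R gT) ffunE (bigD1 x) //= ffunE eqxx.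
by rewrite big1 ?addr0 // => y; rewrite ffunE eq_sym => /negPf->.
Qed.

Lemma galg_sum_central f : f * galg_sum = galg_sum * f.
Proof.
rewrite galg_sumE; apply/ffunP=> x; rewrite !ffunE.
rewrite [RHS](reindex_inj invg_inj) /= [RHS](reindex_inj (mulIg x^-1%g)) /=.
by apply: eq_bigr => y _; rewrite !ffunE mulr1 mul1r invgK mulgKV.
Qed.

Lemma galg_sum_sqr : galg_sum * galg_sum = galg_sum *+ #|gT|.
Proof.
rewrite galg_sumE; apply/ffunP=> x; rewrite !ffunE.
under eq_bigr do rewrite !ffunE mulr1.
by rewrite sumr_const ffunMnE ffunE.
Qed.

End GroupAlgebra.

Section FiniteGroupAlgebra.

Variables (R : finNzRingType) (gT : finGroupType).

HB.instance Definition _ :=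
  Finite.copy (group_algebra R gT) {ffun gT -> R}.

HB.instance Definition _ := FinRing.isNzRing.Build (group_algebra R gT).

End FiniteGroupAlgebra.

(* The generating set is {1 + galg_sum} as soon as 1 + galg_sum is a unit,     *)
(* i.e. for gT of even order (galg_1Dsum_unit). V is central, so the quotient  *)
(* by it is the genuine one, with no implicit restriction to a normaliser.     *)
Definition galg_V (gT : finGroupType) : {group {unit group_algebra 'F_2 gT}} :=
  <<[set u : {unit group_algebra 'F_2 gT} |
       FinRing.uval u == 1 + galg_sum 'F_2 gT]>>%G.

Arguments galg_V gT%_type.

Lemma galg_1Dsum_unit (gT : finGroupType) :
  ~~ odd #|gT| -> 1 + galg_sum 'F_2 gT \is a GRing.unit.
Proof.
move=> evG; set s := galg_sum _ _.
have s2 : s * s = 0.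
  rewrite galg_sum_sqr galg_sumE; apply/ffunP=> x.
  rewrite ffunMnE !ffunE; apply/eqP.
  by rewrite -(dvdn_pcharf (pchar_Fp (isT : prime 2))) dvdn2.
apply/unitrP; exists (1 - s).
by rewrite !(mulrDl, mulrDr, mulrN, mulNr) s2 !mul1r !mulr1 oppr0 !addr0
  addrK subrK.
Qed.

Lemma galg_V_normal (gT : finGroupType) :
  (galg_V gT <| [set: {unit group_algebra 'F_2 gT}])%g.
Proof.
rewrite /normal subsetT /=; apply: cents_norm.
rewrite centsC gen_subG; apply/subsetP=> u; rewrite inE => /eqP uE.
apply/centP=> v _; apply/val_inj; rewrite /= uE.
by rewrite mulrDl mulrDr mul1r mulr1 galg_sum_central.
Qed.

(* Main.v *)
Require Import Defs.
From HB Require Import structures.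
From mathcomp Require Import all_boot all_order all_fingroup all_algebra.
From mathcomp Require Import all_solvable all_field.

(** Write A for the group algebra of the dihedral group D over F_2, and let a
    be the rotation of order p and b the reflection.  Fix a primitive p-th root
    of unity z in an algebraic closure of F.  For r prime to p the formulas

      a |-> [[0, 1], [-1, t]],   b |-> [[0, 1], [1, 0]],   t = z^r + z^-r,

    define a representation of D in which (1, z^r) and (1, z^-r) are
    eigenvectors of a that b interchanges up to scalars.  It has coefficients
    in the finite field F as soon as t does, that is, as soon as t is fixed by
    the Frobenius power x |-> x^|F|.  With |F| = 2^m this holds because
    2^m = 1 or -1 mod p: the power either fixes or swaps z^r and z^-r.

    Let r run over representatives of the cosets of the group of residues
    +-2^i in the units mod p; there are k = (p-1)/(2m) of them.  Extending
    linearly gives k ring maps A -> M_2(F), and with the augmentation a ring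
    map Psi : A -> M_2(F)^k x F_2.

    The kernel of Psi is {0, s}, s being the sum of all group elements
    (galg_repr_kernel).  Indeed f is coded by two polynomials of degree < p
    over F_2, its coefficients on the rotations and on the reflections.  When
    the representations kill f these polynomials vanish at all z^r and z^-r,
    hence, by Frobenius, at every p-th root of unity other than 1, so that
    their coefficients are constant (constant_of_unity_roots); the augmentation
    forces the two constants to agree.

    Since |A| = 2^(2p) = 2 |M_2(F)^k x F_2|, Psi is onto
    (phi_augmentation_surj).  An element that Psi sends to a unit is itself a
    unit, because 1 and 1 + s are, so the units of A map onto GL_2(F)^k; the
    kernel there consists of 1 and 1 + s, which is V (units_mod_V).

    The two parities of d only differ in the generator g of the group of
    residues +-2^i, whose order is 2m: it is 2 when d is even, as -1 is then a
    power of 2, and -2 when d is odd (order_neg_two). *)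

Set Implicit Arguments.
Unset Strict Implicit.
Unset Printing Implicit Defensive.

Import GRing.Theory.
Local Open Scope ring_scope.

(** * Ring maps out of a group algebra *)

Section LinearExtension.

Variables (R : nzRingType) (S : finComUnitRingType) (iota : {rmorphism R -> S}).
Variables (gT : finGroupType) (n : nat).
Variable rho : {morphism [set: gT] >-> {'GL_n[S]}}.
Implicit Types f g : group_algebra R gT.

Definition galg_repr f : 'M[S]_n.-1.+1 := \sum_x iota (f x) *: GLval (rho x).

Fact galg_repr_is_zmod_morphism : zmod_morphism galg_repr.
Proof.
move=> f g; rewrite /galg_repr -sumrB; apply: eq_bigr => x _.
by rewrite !ffunE rmorphB scalerBl.
Qed.

HB.instance Definition _ := GRing.isZmodMorphism.Build
  (group_algebra R gT) 'M[S]_n.-1.+1 galg_repr galg_repr_is_zmod_morphism.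

Fact galg_repr_is_monoid_morphism : monoid_morphism galg_repr.
Proof.
split=> [|f g]; rewrite /galg_repr.
  rewrite (bigD1 1%g) //= ffunE eqxx rmorph1 scale1r morph1 big1 ?addr0 //.
  by move=> x /negPf nx1; rewrite ffunE nx1 rmorph0 scale0r.
rewrite mulr_suml.
under eq_bigr => x _ do rewrite ffunE rmorph_sum scaler_suml.
rewrite exchange_big; apply: eq_bigr => y _ /=.
rewrite (reindex_inj (mulgI y)) /= mulr_sumr; apply: eq_bigr => x _.
rewrite mulKg rmorphM morphM ?inE //=.
by rewrite -scalerAl -scalerAr scalerA.
Qed.

HB.instance Definition _ := GRing.isMonoidMorphism.Build
  (group_algebra R gT) 'M[S]_n.-1.+1 galg_repr galg_repr_is_monoid_morphism.

End LinearExtension.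

Definition augmentation (R : nzRingType) (gT : finGroupType)
  (f : group_algebra R gT) : R := \sum_x f x.

Section Augmentation.

Variables (R : nzRingType) (gT : finGroupType).

Fact augmentation_is_zmod_morphism : zmod_morphism (@augmentation R gT).
Proof.
move=> f g; rewrite /augmentation -sumrB.
by apply: eq_bigr => x _; rewrite !ffunE.
Qed.

HB.instance Definition _ := GRing.isZmodMorphism.Build
  (group_algebra R gT) R (@augmentation R gT) augmentation_is_zmod_morphism.

Fact augmentation_is_monoid_morphism : monoid_morphism (@augmentation R gT).
Proof.
split=> [|f g]; rewrite /augmentation.
  rewrite (bigD1 1%g) //= ffunE eqxx big1 ?addr0 //.
  by move=> x /negPf nx1; rewrite ffunE nx1.
rewrite mulr_suml; under eq_bigr => x _ do rewrite ffunE.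
rewrite exchange_big; apply: eq_bigr => y _ /=.
rewrite (reindex_inj (mulgI y)) /= mulr_sumr; apply: eq_bigr => x _.
by rewrite mulKg.
Qed.

HB.instance Definition _ := GRing.isMonoidMorphism.Build
  (group_algebra R gT) R (@augmentation R gT) augmentation_is_monoid_morphism.

End Augmentation.

(** * Units of a group algebra over the field with two elements *)

Lemma two_sided_divisor_unit (R : unitRingType) (x y : R) :
  x * y \is a GRing.unit -> y * x \is a GRing.unit -> x \is a GRing.unit.
Proof.
move=> Uxy Uyx; apply/unitrP.
have xr : x * (y * (x * y)^-1) = 1 by rewrite mulrA mulrV.
have lx : (y * x)^-1 * y * x = 1 by rewrite -mulrA mulVr.
exists (y * (x * y)^-1); split=> //; rewrite -[RHS]lx; congr (_ * x).
by rewrite -[RHS]mulr1 -xr mulrA lx mul1r.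
Qed.

Lemma F2_neq0 (x : 'F_2) : x != 0 -> x = 1.
Proof. by case: x => [[|[|n]] i] // _; apply/val_inj. Qed.

Lemma sqr_F2 (c : 'F_2) : c ^+ 2 = c.
Proof. by have [->|/F2_neq0->] := eqVneq c 0; rewrite ?expr1n ?expr0n. Qed.

Definition F2_embedding (F : finFieldType) (chF : 2 \in [pchar F]) :
    {rmorphism 'F_2 -> F} :=
  (GRing.in_alg (pPrimeCharType chF) :
     {rmorphism 'F_2 -> pPrimeCharType chF}).

Section UnitsModV.

Variables (gT : finGroupType) (B : finUnitRingType) (k : nat).
Variable phi : 'I_k -> {rmorphism group_algebra 'F_2 gT -> B}.
Hypothesis even_gT : ~~ odd #|gT|.
Hypothesis phi_ker : forall f : group_algebra 'F_2 gT,
    (forall l, phi l f = 0) -> augmentation f = 0 ->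
  f = 0 \/ f = galg_sum 'F_2 gT.
Hypothesis phi_sum : forall l, phi l (galg_sum 'F_2 gT) = 0.
Hypothesis card_phi : (2 ^ #|gT| = 4 * #|B| ^ k)%N.

(** The hyperplane of the f with f 1 = 0 meets the joint kernel of the phi l
    and the augmentation trivially, since all coefficients of the sum of the
    group are 1; and it has exactly as many elements as the target. *)
Lemma phi_augmentation_surj (M : 'I_k -> B) (c : 'F_2) :
  exists f, (forall l, phi l f = M l) /\ augmentation f = c.
Proof.
pose S := [set f : group_algebra 'F_2 gT | f 1%g == 0].
pose Psi (f : group_algebra 'F_2 gT) : {ffun 'I_k -> B} * 'F_2 :=
  ([ffun l => phi l f], augmentation f).
have Psi_inj : {in S &, injective Psi}.
  move=> f g; rewrite !inE => /eqP f1 /eqP g1 [/ffunP eq_phi eq_aug].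
  have fg1 : (f - g) 1%g = 0 by rewrite !ffunE f1 g1 subrr.
  case: (@phi_ker (f - g)).
  - by move=> l; move: (eq_phi l); rewrite !ffunE rmorphB => ->; rewrite subrr.
  - by rewrite rmorphB /= eq_aug subrr.
  - by move/eqP; rewrite subr_eq0 => /eqP.
  by move=> Efg; move: fg1; rewrite Efg galg_sumE ffunE.
have cardS : (#|S| * 2 = 2 ^ #|gT|)%N.
  have -> : #|S| = #|family (fun x : gT =>
      if x == 1%g then pred1 (0 : 'F_2) else predT)|.
    apply: eq_card => f; rewrite inE; apply/eqP/familyP => [f1 x|/(_ 1%g)].
      by case: eqP => // ->; rewrite inE f1.
    by rewrite eqxx inE => /eqP.
  rewrite card_family foldrE big_map big_enum /= (bigD1 1%g) //= eqxx card1.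
  rewrite mul1n (eq_bigr (fun=> 2)) => [|x /negPf->]; last first.
    by rewrite (eq_card (B := 'F_2)) ?card_Fp.
  rewrite prod_nat_const -expnSr; congr (_ ^ _)%N.
  rewrite [RHS](cardD1 1%g) inE add1n; congr _.+1; apply: eq_card => x.
  by rewrite !inE andbT.
have PsiS : Psi @: S = setT.
  apply/eqP; rewrite eqEcard subsetT cardsT card_in_imset //.
  rewrite card_prod card_ffun card_ord card_Fp //.
  rewrite -(leq_pmul2r (isT : (0 < 2)%N)) cardS card_phi -mulnA mulnC.
  exact: leqnn.
have: ([ffun l => M l], c) \in Psi @: S by rewrite PsiS inE.
case/imsetP=> f _ [/ffunP Ephi Eaug]; exists f.
by split=> // l; move: (Ephi l); rewrite !ffunE.
Qed.

Let u0 : {unit group_algebra 'F_2 gT} :=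
  FinRing.unit (group_algebra 'F_2 gT) (galg_1Dsum_unit even_gT).

Lemma galg_V_cycle : galg_V gT = <[u0]>%G.
Proof.
apply/val_inj; congr (generated _); apply/setP=> u; rewrite !inE.
by rewrite -val_eqE.
Qed.

Lemma addff_F2 (f : group_algebra 'F_2 gT) : f + f = 0.
Proof.
apply/ffunP=> x; rewrite !ffunE -mulr2n; apply/eqP.
by rewrite -mulr_natr (pcharf0 (pchar_Fp (isT : prime 2))) mulr0.
Qed.

Lemma card_galg_V : #|galg_V gT| = 2.
Proof.
rewrite galg_V_cycle -orderE; apply: nt_prime_order => //.
  apply/val_inj; rewrite FinRing.val_unitX /= expr2 mulrDl mul1r mulrDr mulr1.
  rewrite addrA -[1 + _ + _]addrA addff_F2 addr0 galg_sum_sqr.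
  rewrite -(odd_double_half #|gT|) (negPf even_gT) add0n -muln2 mulrnA mulr2n.
  by rewrite addff_F2 addr0.
apply/eqP=> /(congr1 val) /= /eqP; rewrite -subr_eq0 addrC addKr.
by rewrite galg_sumE => /eqP/ffunP/(_ 1%g)/eqP; rewrite !ffunE oner_eq0.
Qed.

(** Preimages of a tuple of units and of the tuple of inverses multiply to an
    element that every phi l sends to 1.  Choosing them of augmentation 1 makes
    this element 1 or 1 + galg_sum, which are both units. *)
Lemma units_mod_V :
  ([set: {unit group_algebra 'F_2 gT}] / galg_V gT)%g
     \isog setXn (fun _ : 'I_k => [set: {unit B}]).
Proof.
pose A := group_algebra 'F_2 gT.
pose Phi (u : {unit A}) : {dffun forall l : 'I_k, {unit B}} :=
  [ffun l => FinRing.unit B (rmorph_unit (phi l) (valP u))].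
have PhiM : {in [set: {unit A}] &, {morph Phi : u v / (u * v)%g}}.
  move=> u v _ _; apply/ffunP=> l; rewrite !ffunE; apply/val_inj => /=.
  by rewrite rmorphM.
pose fPhi := Morphism PhiM.
have im_Phi : (fPhi @* setT)%g = setXn (fun _ : 'I_k => [set: {unit B}]).
  apply/eqP; rewrite eqEsubset; apply/andP; split; apply/subsetP=> M _.
    by apply/setXnP=> l; rewrite inE.
  pose lift c := phi_augmentation_surj c 1.
  have [f [phi_f aug_f]] := lift (fun l => val (M l)).
  have [g [phi_g aug_g]] := lift (fun l => val (M l)^-1%g).
  have unit1 h : (forall l, phi l h = 1) -> augmentation h = 1 ->
      h \is a GRing.unit.
    move=> phi_h aug_h; case: (@phi_ker (h - 1)) => [l|||].
    - by rewrite rmorphB rmorph1 phi_h subrr.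
    - by rewrite rmorphB rmorph1 /= aug_h subrr.
    - by move/eqP; rewrite subr_eq0 => /eqP->; apply: unitr1.
    move/eqP; rewrite subr_eq addrC => /eqP->; exact: galg_1Dsum_unit.
  have Ufg : f * g \is a GRing.unit.
    apply: unit1 => [l|]; last by rewrite rmorphM /= aug_f aug_g mulr1.
    by rewrite rmorphM phi_f phi_g; exact: (congr1 val (mulgV (M l))).
  have Ugf : g * f \is a GRing.unit.
    apply: unit1 => [l|]; last by rewrite rmorphM /= aug_f aug_g mulr1.
    by rewrite rmorphM phi_f phi_g; exact: (congr1 val (mulVg (M l))).
  have Uf := two_sided_divisor_unit Ufg Ugf.
  apply/imsetP; exists (FinRing.unit _ Uf); first by rewrite !inE.
  by apply/ffunP=> l; rewrite ffunE; apply/val_inj; rewrite /= phi_f.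
have ker_Phi : ('ker fPhi)%g = galg_V gT.
  apply/eqP; rewrite eqEsubset; apply/andP; split; last first.
    rewrite galg_V_cycle cycle_subG; apply/kerP; rewrite ?inE //.
    apply/ffunP=> l; rewrite !ffunE; apply/val_inj.
    by rewrite /= rmorphD rmorph1 phi_sum addr0.
  apply/subsetP=> u; case/morphpreP=> _ /set1P/ffunP Phi_u.
  have phi_u l : phi l (val u) = 1.
    by move: (Phi_u l); rewrite !ffunE => /(congr1 val).
  have aug_u : augmentation (val u) = 1.
    have := rmorph_unit (@augmentation 'F_2 gT) (valP u).
    by rewrite unitfE => /F2_neq0.
  have u_cases: (val u == 1) || (val u == 1 + galg_sum 'F_2 gT).
    case: (@phi_ker (val u - 1)) => [l|||].
    - by rewrite rmorphB rmorph1 phi_u subrr.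
    - by rewrite rmorphB rmorph1 /= aug_u subrr.
    - by move/eqP; rewrite subr_eq0 => ->.
    by move/eqP; rewrite subr_eq addrC => ->; rewrite orbT.
  case/orP: u_cases => [/eqP u1|uV]; last by rewrite mem_gen ?inE.
  by rewrite (_ : u = 1%g) ?group1 //; apply/val_inj.
rewrite -im_Phi -ker_Phi; exact: first_isog.
Qed.

Lemma card_units :
  #|[set: {unit group_algebra 'F_2 gT}]| = (2 * #|[set: {unit B}]| ^ k)%N.
Proof.
rewrite -(Lagrange (subsetT (galg_V gT))) card_galg_V -card_quotient.
  by rewrite (card_isog units_mod_V) cardsXn prod_nat_const card_ord.
by case/andP: (galg_V_normal gT).
Qed.

End UnitsModV.

(** * Dihedral groups *)

Section DihedralGroups.
Local Open Scope group_scope.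

Lemma dihedral_generators q : (1 < q)%N ->
  exists a b : 'D_(2 * q),
    [/\ #[a] = q, #[b] = 2, a ^ b = a^-1 & <[a]> ><| <[b]> = [set: 'D_(2 * q)]].
Proof.
move=> q_gt1; have oD : #|'D_(2 * q)| = (2 * q)%N.
  by rewrite mul2n card_dihedral.
have: 'D_(2 * q) \homg Grp (x : y : x ^+ q, y ^+ 2, x ^ y = x^-1).
  by rewrite mul2n -Grp_dihedral ?homg_refl.
case/existsP=> -[a b] /= /eqP[defG aq b2 ab].
have nab : <[b]> \subset 'N(<[a]>) by rewrite norms_cycle ab groupV cycle_id.
have{} defG: <[a]> * <[b]> = 'D_(2 * q) by rewrite -norm_joinEr.
(* Otherwise a would generate a group of order 2 * q, although a ^+ q = 1. *)
have notXb: b \notin <[a]>.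
  apply/negP=> Xb.
  have oa : #[a] = (2 * q)%N.
    by rewrite orderE -[RHS]oD -defG mulGSid ?cycle_subG.
  have := order_dvdn a q; rewrite aq eqxx oa => /dvdn_leq.
  move/(_ (ltnW q_gt1)); rewrite mul2n -addnn -[X in (_ <= X)%N]addn0.
  by rewrite leq_add2l leqNgt ltnW.
have ob: #[b] = 2 by apply: nt_prime_order (group1_contra notXb).
have tiab : <[a]> :&: <[b]> = 1.
  by rewrite setIC prime_TIg ?cycle_subG // -orderE ob.
have oa: #[a] = q.
  have := oD; rewrite -defG TI_cardMg // -!orderE ob mulnC => /eqP.
  by rewrite eqn_pmul2l // => /eqP.
by exists a, b; split=> //; rewrite sdprodE.
Qed.

Section Presentation.

Variables (gT rT : finGroupType) (a b : gT) (A B : rT) (q : nat).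
Hypotheses (oa : #[a] = q) (ob : #[b] = 2) (ab : a ^ b = a^-1).
Hypothesis defG : <[a]> ><| <[b]> = [set: gT].

(** The presentation of the dihedral group only yields some morphism onto the
    group generated by A and B; gluing the morphisms of the two cyclic factors
    controls the images of a and b. *)
Lemma dihedral_morphism : A ^+ q = 1 -> B * B = 1 -> A * B * A = B ->
  exists rho : {morphism [set: gT] >-> rT}, rho a = A /\ rho b = B.
Proof.
move=> Aq BB ABA; have B2 : B ^+ 2 = 1 by rewrite expgS expg1.
have AB : A ^ B = A^-1.
  apply/eqP; rewrite eq_sym eq_invg_mul conjgE.
  rewrite (_ : B^-1 = B) ?mulgA ?ABA ?BB //.
  by apply/eqP; rewrite eq_invg_mul BB.
have dvdA : (#[A] %| #[a])%N by rewrite order_dvdn oa Aq.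
have dvdB : (#[B] %| #[b])%N by rewrite order_dvdn ob B2.
have nab : {in <[a]>, forall x, x ^ b \in <[a]>}.
  by move=> _ /cycleP[i ->]; rewrite conjXg ab expVgn groupV mem_cycle.
have conjb : {in <[a]>, forall x, eltm dvdA (x ^ b) = eltm dvdA x ^ B}.
  move=> _ /cycleP[i ->].
  by rewrite conjXg ab expVgn morphV ?mem_cycle //= eltmE conjXg AB expVgn.
have actf : {in <[a]> & <[b]>, morph_act 'J 'J (eltm dvdA) (eltm dvdB)}.
  move=> x _ ax /cycleP[j ->] /=; rewrite eltmE.
  elim: j x ax => [|j IHj] x ax; first by rewrite !conjg1.
  by rewrite !expgS !conjgM IHj ?nab // conjb.
exists (sdprodm_morphism defG actf); split=> /=.
  by rewrite sdprodmEl ?cycle_id //; apply: eltm_id.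
by rewrite sdprodmEr ?cycle_id //; apply: eltm_id.
Qed.

Lemma mem_dihedral x :
  exists2 i, (i < q)%N & x = a ^+ i \/ x = a ^+ i * b.
Proof.
have [_ defab _ _] := sdprodP defG.
have q_gt0 : (0 < q)%N by rewrite -oa order_gt0.
have: x \in <[a]> * <[b]> by rewrite defab inE.
case/mulsgP=> _ v /cycleP[i ->]; rewrite cycle2g // !inE => v_b ->.
exists (i %% q)%N; first by rewrite ltn_mod.
rewrite -[q in (_ %% q)%N]oa expg_mod_order.
by case/orP: v_b => /eqP->; rewrite ?mulg1; [left | right].
Qed.

Lemma big_dihedral (R : Type) (idx : R) (op : Monoid.com_law idx)
    (E : gT -> R) :
  \big[op/idx]_x E x =
    op (\big[op/idx]_(i < q) E (a ^+ i)) (\big[op/idx]_(i < q) E (a ^+ i * b)).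
Proof.
case/sdprodP: defG => _ defab _ tiab.
have big_cycle (E' : gT -> R) :
  \big[op/idx]_(x in <[a]>) E' x = \big[op/idx]_(i < q) E' (a ^+ i).
  have -> : <[a]> = [set a ^+ i | i : 'I_q].
    apply/setP=> x; apply/cycleP/imsetP=> [[i ->]|[i _ ->]]; last by exists i.
    have q_gt0 : (0 < q)%N by rewrite -oa order_gt0.
    exists (Ordinal (ltn_pmod i q_gt0)) => //=.
    by rewrite -{1}oa -expg_mod_order.
  rewrite big_imset //= => i j _ _ /eqP.
  rewrite eq_expg_mod_order oa !modn_small // => /eqP; exact: val_inj.
rewrite -(big_cycle E) -(big_cycle (fun x => E (x * b))).
rewrite [LHS](bigID [in <[a]>]) /=; congr (op _ _).
rewrite (reindex_inj (mulIg b)) /=; apply: eq_bigl => x.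
have b_notin : b \notin <[a]>.
  apply/negP=> ba; have: b \in <[a]> :&: <[b]> by rewrite inE ba cycle_id.
  by rewrite tiab inE -order_eq1 ob.
have [xa|xNa] := boolP (x \in <[a]>); first by rewrite groupMl.
have: x \in <[a]> * <[b]> by rewrite defab inE.
case/mulsgP=> u v ua; rewrite cycle2g // !inE.
case/orP=> /eqP-> xE; first by rewrite xE mulg1 ua in xNa.
have bb : b * b = 1 by have := expg_order b; rewrite ob.
by rewrite xE -mulgA bb mulg1 ua.
Qed.

End Presentation.
End DihedralGroups.

(** * Roots of unity *)

Lemma prim_root_neq0 (R : idomainType) n (z : R) :
  n.-primitive_root z -> z != 0.
Proof.
move=> prim_z; apply/eqP=> z0; have /eqP := prim_expr_order prim_z.
by rewrite z0 expr0n gtn_eqF ?(prim_order_gt0 prim_z) // eq_sym oner_eq0.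
Qed.

Lemma prim_root_neq_inv (K : fieldType) p (z : K) n :
  odd p -> p.-primitive_root z -> ~~ (p %| n)%N -> z ^+ n != z ^- n.
Proof.
move=> odd_p prim_z np; apply/eqP=> zn; case/negP: np.
have /eqP : z ^+ (n * 2) = 1.
  rewrite exprM expr2 {2}zn mulfV // expf_neq0 //.
  by rewrite (prim_root_neq0 prim_z).
by rewrite -(prim_order_dvd prim_z) Gauss_dvdl // coprimen2.
Qed.

Lemma closed_prim_root_exists (K : closedFieldType) p :
  prime p -> p%:R != 0 :> K -> exists z : K, p.-primitive_root z.
Proof.
move=> p_prime p_neq0; have p_gt1 := prime_gt1 p_prime.
have p_gt0 := ltnW p_gt1.
(* A root of 1 + X + ... + X^(p-1) is a p-th root of unity, and it is not 1
   because the value of that polynomial at 1 is p. *)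
pose Phi : {poly K} := \poly_(i < p) 1.
have szPhi : size Phi = p.
  rewrite -(prednK p_gt0) in Phi *.
  by apply: size_poly_eq; rewrite oner_eq0.
have [z /rootP] : exists z, root Phi z.
  by apply/closed_rootP; rewrite szPhi gtn_eqF.
rewrite horner_poly; under eq_bigr do rewrite mul1r; move=> sum0; exists z.
have zp : z ^+ p = 1 by apply/eqP; rewrite -subr_eq0 subrX1 sum0 mulr0.
have z1 : z != 1.
  apply: contraNneq p_neq0 => z1; apply/eqP; rewrite -sum0 z1.
  by under eq_bigr do rewrite expr1n; rewrite sumr_const card_ord.
have [n prim_z] := prim_order_exists p_gt0 zp.
case/primeP: p_prime => _ /[apply] /pred2P[n1 | <- //].
by move: z1 (prim_expr_order prim_z); rewrite n1 expr1 => /eqP.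
Qed.

Lemma root_Frobenius (K : fieldType) (P : {poly K}) z i :
    2 \in [pchar K] -> (forall j, P`_j ^+ 2 = P`_j) ->
  root P z -> root P (z ^+ (2 ^ i)).
Proof.
move=> chK P2 Pz; elim: i => [|i]; first by rewrite expn0 expr1.
rewrite expnSr exprM; set w := z ^+ _ => /rootP Pw; apply/rootP.
have PF : map_poly (pFrobenius_aut chK) P = P.
  by apply/polyP=> j; rewrite coef_map /= pFrobenius_autE P2.
by rewrite -(pFrobenius_autE chK) -[P in LHS]PF horner_map Pw rmorph0.
Qed.

(** Subtracting the multiple of 1 + X + ... + X^(p-1) that cancels the leading
    coefficient leaves a polynomial of degree < p - 1 with p - 1 roots. *)
Lemma constant_of_unity_roots (K : fieldType) p (z : K) (P : {poly K}) :
    p.-primitive_root z -> (size P <= p)%N ->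
    (forall j, (0 < j < p)%N -> root P (z ^+ j)) ->
  forall i, (i < p)%N -> P`_i = P`_0.
Proof.
move=> prim_z leP rootP; have p_gt0 := prim_order_gt0 prim_z.
pose Q := P - P`_p.-1 *: \poly_(i < p) 1.
have Q0 : Q = 0.
  apply: (@roots_geq_poly_eq0 _ _ [seq z ^+ j | j <- iota 1 p.-1]).
  - apply/allP=> x /mapP[j]; rewrite mem_iota add1n prednK // => jp ->.
    rewrite /root hornerD hornerN hornerZ (eqP (rootP j jp)) sub0r oppr_eq0.
    rewrite mulf_eq0; apply/orP; right.
    have nz1 : z ^+ j - 1 != 0.
      by rewrite subr_eq0 -(prim_order_dvd prim_z) gtnNdvd //; case/andP: jp.
    rewrite -(mulrI_eq0 _ (mulfI nz1)) horner_poly.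
    under eq_bigr do rewrite mul1r.
    by rewrite -subrX1 -exprM mulnC exprM (prim_expr_order prim_z) expr1n subrr.
  - rewrite map_inj_in_uniq ?iota_uniq // => i j.
    rewrite !mem_iota add1n prednK // => /andP[_ ip] /andP[_ jp] /eqP.
    by rewrite (eq_prim_root_expr prim_z) !modn_small // => /eqP.
  rewrite size_map size_iota; apply/leq_sizeP => i.
  rewrite leq_eqVlt => /predU1P[<-|].
    by rewrite coefB coefZ coef_poly prednK // leqnn mulr1 subrr.
  rewrite prednK // => pi; rewrite coefB coefZ coef_poly ltnNge pi mulr0 subr0.
  by apply: (leq_sizeP _ _ leP).
move=> i ip; have := Q0; rewrite /Q => /eqP; rewrite subr_eq0 => /eqP->.
by rewrite !coefZ !coef_poly ip p_gt0.
Qed.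

(** The elements of F are already all the roots of X^|F| - X. *)
Lemma fixed_by_card_in_image (F : finFieldType) (K : fieldType)
    (iota : {rmorphism F -> K}) (s : K) :
  s ^+ #|F| = s -> exists t, iota t = s.
Proof.
move=> sF; have : root (map_poly iota (\prod_(x : F) ('X - x%:P))) s.
  rewrite -finField_genPoly rmorphB /= map_polyXn map_polyX /root !hornerE.
  by rewrite sF subrr.
rewrite rmorph_prod /= /root horner_prod.
case/prodf_eq0 => t _; rewrite rmorphB /= map_polyX map_polyC !hornerE.
by rewrite subr_eq0 => /eqP->; exists t.
Qed.

(** * Rotations and reflections of the plane *)

Section PlaneMatrices.

Variable F : comNzRingType.

Definition rotation_mx (t : F) : 'M[F]_2 :=
  \matrix_(i, j) if i == 0 then (j == 1)%:R else if j == 0 then -1 else t.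
Definition reflection_mx : 'M[F]_2 := \matrix_(i, j) (i != j)%:R.
Definition eigen_col (z : F) : 'cV[F]_2 := \col_i (if i == 0 then 1 else z).

Lemma rotation_eigen t z z' : z * z' = 1 -> t = z + z' ->
  rotation_mx t *m eigen_col z = z *: eigen_col z.
Proof.
move=> zz' tE; apply/matrixP=> i j; rewrite !mxE !big_ord_recl big_ord0 !mxE /=.
case: i => [[|[|//]] i] /=;
  rewrite -?val_eqE /= ?mulr1 ?mul1r ?mul0r ?add0r ?addr0 //.
by rewrite tE mulrDl [z' * z]mulrC zz' addrCA addNr addr0.
Qed.

Lemma reflection_eigen z z' : z * z' = 1 ->
  reflection_mx *m eigen_col z = z *: eigen_col z'.
Proof.
move=> zz'; apply/matrixP=> i j; rewrite !mxE !big_ord_recl big_ord0 !mxE /=.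
by case: i => [[|[|//]] i] /=;
  rewrite -?val_eqE /= ?mulr1 ?mul1r ?mul0r ?add0r ?addr0.
Qed.

Lemma rotationX_eigen t z z' i : z * z' = 1 -> t = z + z' ->
  rotation_mx t ^+ i *m eigen_col z = z ^+ i *: eigen_col z.
Proof.
move=> zz' tE; elim: i => [|i IHi]; first by rewrite !expr0 mul1mx scale1r.
rewrite exprSr -mulmxE -mulmxA (rotation_eigen zz' tE).
by rewrite -scalemxAr IHi scalerA exprS.
Qed.

Lemma reflection_sqr : reflection_mx *m reflection_mx = 1%:M.
Proof.
apply/matrixP=> i j; rewrite !mxE !big_ord_recl big_ord0 !mxE /=.
by case: i j => [[|[|//]] i] [[|[|//]] j];
  rewrite /= ?mulr1 ?mul1r ?mul0r ?add0r ?addr0.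
Qed.

End PlaneMatrices.

Lemma map_rotation_mx (F K : comNzRingType) (iota : {rmorphism F -> K}) t :
  map_mx iota (rotation_mx t) = rotation_mx (iota t).
Proof.
apply/matrixP=> i j; rewrite !mxE.
by do 2?case: ifP; rewrite ?rmorphN1 // rmorph_nat.
Qed.

Lemma map_reflection_mx (F K : comNzRingType) (iota : {rmorphism F -> K}) :
  map_mx iota (reflection_mx F) = reflection_mx K.
Proof. by apply/matrixP=> i j; rewrite !mxE rmorph_nat. Qed.

Lemma eq0_on_eigen_cols (F : fieldType) (z z' : F) (M : 'M[F]_2) : z != z' ->
  M *m eigen_col z = 0 -> M *m eigen_col z' = 0 -> M = 0.
Proof.
move=> nzz' Mz Mz'; apply/matrixP=> i j.
move/matrixP/(_ i 0): Mz; move/matrixP/(_ i 0): Mz'.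
rewrite !mxE !big_ord_recl !big_ord0 !mxE /= !addr0 !mulr1.
set x := M i ord0; set y := M i _ => h' h.
have /eqP : y * (z - z') = 0.
  by rewrite mulrBr -[y * z](addKr x) h -[y * z'](addKr x) h' subrr.
rewrite mulf_eq0 subr_eq0 (negPf nzz') orbF => /eqP y0.
move: h; rewrite y0 mul0r addr0 => x0.
by case: j => [[|[|//]] j]; [rewrite -x0 | rewrite -y0];
  congr (M _ _); apply/val_inj.
Qed.

Lemma eigen_cols_free (F : fieldType) (z z' x y : F) : z != z' ->
  x *: eigen_col z + y *: eigen_col z' = 0 -> x = 0 /\ y = 0.
Proof.
move=> nzz' /matrixP E.
move: (E 0 0) (E (lift ord0 ord0) 0); rewrite !mxE /= !mulr1 => xy0 h.
have yE : y = - x by apply/eqP; rewrite -addr_eq0 addrC xy0.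
have /eqP: x * (z - z') = 0 by rewrite mulrBr -mulNr -yE.
rewrite mulf_eq0 subr_eq0 (negPf nzz') orbF => /eqP x0.
by rewrite yE x0 oppr0.
Qed.

(** The dihedral relations are checked on the two eigenvectors. *)
Section DihedralRelations.

Variables (K : fieldType) (t z z' : K).
Hypotheses (zz' : z * z' = 1) (tE : t = z + z') (nzz' : z != z').

Let z'z : z' * z = 1. Proof. by rewrite mulrC. Qed.
Let tE' : t = z' + z. Proof. by rewrite addrC. Qed.

Lemma rotation_order q : z ^+ q = 1 -> rotation_mx t ^+ q = 1.
Proof.
move=> zq; apply/eqP; rewrite -subr_eq0; apply/eqP.
have z'q : z' ^+ q = 1.
  by rewrite -[LHS]mul1r -[X in X * _]zq -exprMn zz' expr1n.
apply: (eq0_on_eigen_cols nzz'); rewrite mulmxBl mul1mx.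
  by rewrite (rotationX_eigen q zz' tE) zq scale1r subrr.
by rewrite (rotationX_eigen q z'z tE') z'q scale1r subrr.
Qed.

Lemma rotation_reflection :
  rotation_mx t *m reflection_mx K *m rotation_mx t = reflection_mx K.
Proof.
have on_eigen u u' : u * u' = 1 -> t = u + u' ->
    rotation_mx t *m reflection_mx K *m rotation_mx t *m eigen_col u
      = reflection_mx K *m eigen_col u.
  move=> uu' tu; have u'u : u' * u = 1 by rewrite mulrC.
  have tu' : t = u' + u by rewrite addrC.
  rewrite -!mulmxA (rotation_eigen uu' tu) -!scalemxAr (reflection_eigen uu').
  congr (u *: _); rewrite -scalemxAr (rotation_eigen u'u tu').
  by rewrite scalerA uu' scale1r.
apply/eqP; rewrite -subr_eq0; apply/eqP; apply: (eq0_on_eigen_cols nzz').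
  by rewrite mulmxBl (on_eigen _ _ zz' tE) subrr.
by rewrite mulmxBl (on_eigen _ _ z'z tE') subrr.
Qed.

End DihedralRelations.

(** * Two-dimensional representations of a dihedral group *)

Section DihedralRepresentation.

Variables (gT : finGroupType) (a b : gT) (q : nat).
Hypotheses (oa : #[a]%g = q) (ob : #[b]%g = 2) (ab : (a ^ b = a^-1)%g).
Hypothesis defG : (<[a]> ><| <[b]>)%g = [set: gT].
Variables (F : finFieldType) (K : fieldType) (iota : {rmorphism F -> K}).
Variable t : F.

Lemma dihedral_representation (z z' : K) :
    z * z' = 1 -> iota t = z + z' -> z != z' -> z ^+ q = 1 ->
  exists rho : {morphism [set: gT] >-> {'GL_2[F]}},
    GLval (rho a) = rotation_mx t /\ GLval (rho b) = reflection_mx F.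
Proof.
move=> zz' tE nzz' zq; have q_gt0 : (0 < q)%N by rewrite -oa order_gt0.
have Aq : rotation_mx t ^+ q = 1.
  apply: (map_mx_inj (f := iota)); rewrite rmorphXn /= map_rotation_mx.
  by rewrite (rotation_order zz' tE nzz' zq) map_mx1.
have ABA : rotation_mx t *m reflection_mx F *m rotation_mx t = reflection_mx F.
  apply: (map_mx_inj (f := iota)).
  rewrite !map_mxM map_rotation_mx map_reflection_mx.
  exact: rotation_reflection zz' tE nzz'.
have BB := reflection_sqr F.
have UA : rotation_mx t \in unitmx.
  have : rotation_mx t *m rotation_mx t ^+ q.-1 = 1%:M.
    by rewrite mulmxE -exprS prednK.
  by case/mulmx1_unit.
have [UB _] := mulmx1_unit BB.
pose A : {'GL_2[F]} := FinRing.unit 'M[F]_2 UA.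
pose B : {'GL_2[F]} := FinRing.unit 'M[F]_2 UB.
have [|||rho [rhoa rhob]] := dihedral_morphism oa ob ab defG (A := A) (B := B).
- by apply/val_inj; rewrite FinRing.val_unitX.
- exact/val_inj.
- exact/val_inj.
by exists rho; rewrite rhoa rhob.
Qed.

Variables (R : nzRingType) (kappa : {rmorphism R -> F}).

(** For c = 1 and c = b these polynomials record the coefficients of f on the
    rotations and on the reflections. *)
Definition coset_poly (c : gT) (f : group_algebra R gT) : {poly K} :=
  \poly_(i < q) iota (kappa (f (a ^+ i * c)%g)).

Variable rho : {morphism [set: gT] >-> {'GL_2[F]}}.
Hypothesis rho_a : GLval (rho a) = rotation_mx t.
Hypothesis rho_b : GLval (rho b) = reflection_mx F.

Lemma galg_repr_eigen u u' f : u * u' = 1 -> iota t = u + u' ->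
  map_mx iota (galg_repr kappa rho f) *m eigen_col u =
    (coset_poly 1 f).[u] *: eigen_col u
      + (u * (coset_poly b f).[u']) *: eigen_col u'.
Proof.
move=> uu' tu; have u'u : u' * u = 1 by rewrite mulrC.
have tu' : iota t = u' + u by rewrite addrC.
have rhoX i : GLval (rho (a ^+ i)%g) = rotation_mx t ^+ i.
  by rewrite morphX ?inE // -rho_a; apply: FinRing.val_unitX.
have rhoXb i : GLval (rho (a ^+ i * b)%g)
    = rotation_mx t ^+ i *m reflection_mx F.
  by rewrite morphM ?inE // -rho_b -rhoX; apply: GL_MxE.
rewrite /galg_repr (big_dihedral oa ob defG) raddfD mulmxDl /=.
rewrite !raddf_sum !mulmx_suml !horner_poly mulr_sumr !scaler_suml /=.
congr (_ + _); apply: eq_bigr => i _.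
  rewrite mulg1 rhoX map_mxZ -scalemxAl rmorphXn /= map_rotation_mx.
  by rewrite (rotationX_eigen _ uu' tu) scalerA.
rewrite rhoXb map_mxZ map_mxM rmorphXn /= map_rotation_mx.
rewrite map_reflection_mx -scalemxAl -mulmxA (reflection_eigen uu') -scalemxAr.
by rewrite (rotationX_eigen _ u'u tu') !scalerA -mulrA mulrCA.
Qed.

End DihedralRepresentation.

(** * The common kernel of the representations *)

Section KernelOfRepresentations.

Variables (gT : finGroupType) (a b : gT) (p : nat).
Hypotheses (oa : #[a]%g = p) (ob : #[b]%g = 2).
Hypothesis defG : (<[a]> ><| <[b]>)%g = [set: gT].
Hypothesis odd_p : odd p.
Variables (F : finFieldType) (K : fieldType) (iota : {rmorphism F -> K}).
Hypothesis chK : 2 \in [pchar K].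
Variable kappa : {rmorphism 'F_2 -> F}.
Variable z : K.
Hypothesis prim_z : p.-primitive_root z.
Variables (k : nat) (r : 'I_k -> nat) (t : 'I_k -> F).
Hypothesis r_p : forall l, ~~ (p %| r l)%N.
Hypothesis tE : forall l, iota (t l) = z ^+ r l + z ^- r l.
Hypothesis r_cover : forall j, (0 < j < p)%N -> exists l i,
  (j == r l * 2 ^ i %[mod p])%N \/ (p %| j + r l * 2 ^ i)%N.
Variable rho : 'I_k -> {morphism [set: gT] >-> {'GL_2[F]}}.
Hypothesis rho_a : forall l, GLval (rho l a) = rotation_mx (t l).
Hypothesis rho_b : forall l, GLval (rho l b) = reflection_mx F.

Let z_unit l : z ^+ r l * z ^- r l = 1.
Proof. by rewrite mulfV // expf_neq0 // (prim_root_neq0 prim_z). Qed.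

(** Both coset polynomials of the sum of the group are 1 + X + ... + X^(p-1),
    which vanishes at the two eigenvalues of a. *)
Lemma galg_repr_sum l : galg_repr kappa (rho l) (galg_sum 'F_2 gT) = 0.
Proof.
have polyE c : coset_poly a p iota kappa c (galg_sum 'F_2 gT) = \poly_(i < p) 1.
  by apply/polyP=> i; rewrite !coef_poly galg_sumE ffunE !rmorph1.
have root0 u : u ^+ p = 1 -> u != 1 -> (\poly_(i < p) (1 : K)).[u] = 0.
  rewrite -subr_eq0 => up u1; apply: (mulfI u1); rewrite mulr0 horner_poly.
  by under eq_bigr do rewrite mul1r; rewrite -subrX1 up subrr.
have u1 : z ^+ r l != 1 by rewrite -(prim_order_dvd prim_z).
have up : (z ^+ r l) ^+ p = 1.
  by rewrite -exprM mulnC exprM (prim_expr_order prim_z) expr1n.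
have on_eigen u u' : u * u' = 1 -> iota (t l) = u + u' -> u ^+ p = 1 ->
    u != 1 ->
    map_mx iota (galg_repr kappa (rho l) (galg_sum 'F_2 gT)) *m eigen_col u = 0.
  move=> uu' tu upp un.
  rewrite (galg_repr_eigen oa ob defG _ (rho_a l) (rho_b l) _ uu' tu).
  rewrite !polyE root0 // scale0r root0 ?mulr0 ?scale0r ?addr0 //.
    by rewrite -[LHS]mul1r -[X in X * _]upp -exprMn uu' expr1n.
  by apply: contraNneq un => u'1; rewrite -uu' u'1 mulr1.
apply: (map_mx_inj (f := iota)); rewrite map_mx0.
apply: (eq0_on_eigen_cols (prim_root_neq_inv odd_p prim_z (r_p l))).
  exact: on_eigen (z_unit l) (tE l) up u1.
apply: on_eigen; rewrite 1?mulrC 1?addrC //.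
- by rewrite exprVn up invr1.
- by rewrite invr_eq1.
Qed.

(** Each representation forces the two coset polynomials to vanish at z ^+ r l
    and z ^- r l; as their coefficients lie in F_2, Frobenius spreads these
    zeros over all the powers of z reached by r_cover. *)
Lemma galg_repr_kernel (f : group_algebra 'F_2 gT) :
    (forall l, galg_repr kappa (rho l) f = 0) -> augmentation f = 0 ->
  f = 0 \/ f = galg_sum 'F_2 gT.
Proof.
move=> phi_f aug_f; pose P c := coset_poly a p iota kappa c f.
have P2 c j : (P c)`_j ^+ 2 = (P c)`_j.
  rewrite coef_poly; case: ifP => _; last by rewrite expr0n.
  by rewrite -!rmorphXn /= sqr_F2.
have rootP l : [/\ root (P 1%g) (z ^+ r l), root (P 1%g) (z ^- r l),
                   root (P b) (z ^+ r l) & root (P b) (z ^- r l)].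
  have on_eigen u u' : u * u' = 1 -> iota (t l) = u + u' -> u != u' ->
      root (P 1%g) u /\ root (P b) u'.
    move=> uu' tu nuu'.
    have := galg_repr_eigen oa ob defG kappa (rho_a l) (rho_b l) f uu' tu.
    rewrite phi_f map_mx0 mul0mx => /esym/(eigen_cols_free nuu')[/rootP-> /eqP].
    rewrite mulf_eq0 => /orP[/eqP u0|]; last by [].
    by move/eqP: uu'; rewrite u0 mul0r eq_sym oner_eq0.
  have nu := prim_root_neq_inv odd_p prim_z (r_p l).
  have [P1u Pbu'] := on_eigen _ _ (z_unit l) (tE l) nu.
  have [|||P1u' Pbu] := on_eigen (z ^- r l) (z ^+ r l);
    rewrite 1?mulrC 1?addrC //.
  by rewrite eq_sym.
have allroots c : c = 1%g \/ c = b ->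
    forall j, (0 < j < p)%N -> root (P c) (z ^+ j).
  move=> cE j /r_cover[l [i]].
  have [Pu Pu'] : root (P c) (z ^+ r l) /\ root (P c) (z ^- r l).
    by case: cE (rootP l) => -> [].
  case=> [jE | /dvdnP[n jE]].
    have ->: z ^+ j = (z ^+ r l) ^+ (2 ^ i).
      by apply/eqP; rewrite -exprM (eq_prim_root_expr prim_z).
    exact: root_Frobenius.
  have ->: z ^+ j = (z ^- r l) ^+ (2 ^ i).
    apply: (mulIf (x := z ^+ (r l * 2 ^ i))).
      by rewrite expf_neq0 ?(prim_root_neq0 prim_z).
    rewrite -exprD jE mulnC exprM (prim_expr_order prim_z) expr1n.
    by rewrite exprM exprVn mulVf ?expf_neq0 ?(prim_root_neq0 prim_z).
  exact: root_Frobenius.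
have f_const c i : c = 1%g \/ c = b -> (i < p)%N -> f (a ^+ i * c)%g = f c.
  move=> cE ip; apply: (fmorph_inj kappa); apply: (fmorph_inj iota).
  have := constant_of_unity_roots prim_z (size_poly _ _) (allroots c cE) ip.
  by rewrite !coef_poly ip (prim_order_gt0 prim_z) expg0 mul1g.
(* As p is odd, the augmentation of f is f 1 + f b. *)
have fb : f b = f 1%g.
  have p1 : p%:R = 1 :> 'F_2.
    rewrite -(odd_double_half p) odd_p -muln2 natrD natrM.
    by rewrite (pcharf0 (pchar_Fp (isT : prime 2))) mulr0 addr0.
  have eq2 (x y : 'F_2) : x + y = 0 -> y = x.
    move/eqP; rewrite addrC addr_eq0 => /eqP->.
    by rewrite (oppr_pchar2 (pchar_Fp (isT : prime 2))).
  apply: eq2; rewrite -[RHS]aug_f /augmentation (big_dihedral oa ob defG) /=.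
  have sum_c c : c = 1%g \/ c = b -> \sum_(i < p) f (a ^+ i * c)%g = f c.
    move=> cE; rewrite (eq_bigr (fun=> f c)) => [|i _]; last exact: f_const.
    by rewrite sumr_const card_ord -mulr_natr p1 mulr1.
  rewrite (sum_c b); last by right.
  under [in RHS]eq_bigr => i _ do rewrite -[(a ^+ i)%g]mulg1.
  by rewrite sum_c; last left.
have fE x : f x = f 1%g.
  have [i ip [->|->]] := mem_dihedral oa ob defG x.
    by rewrite -[in LHS](mulg1 (a ^+ i)%g) f_const //; left.
  by rewrite f_const //; right.
have [f1|/F2_neq0 f1] := eqVneq (f 1%g) 0; [left | right; rewrite galg_sumE];
  by apply/ffunP=> x; rewrite fE f1 ffunE.
Qed.

End KernelOfRepresentations.

(** The condition on 2 ^ m puts the traces z ^+ r l + z ^- r l into F, although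
    z itself need not lie there. *)
Lemma dihedral_representations (p m k : nat) (F : finFieldType)
    (r : 'I_k -> nat) :
    prime p -> odd p -> #|F| = (2 ^ m)%N ->
    (2 ^ m == 1 %[mod p])%N || (p %| 2 ^ m + 1)%N ->
    (forall l, ~~ (p %| r l)%N) ->
    (forall j, (0 < j < p)%N -> exists l i,
       (j == r l * 2 ^ i %[mod p])%N \/ (p %| j + r l * 2 ^ i)%N) ->
  exists phi : 'I_k -> {rmorphism group_algebra 'F_2 'D_(2 * p) -> 'M[F]_2},
    (forall l, phi l (galg_sum 'F_2 'D_(2 * p)) = 0) /\
    forall f, (forall l, phi l f = 0) -> augmentation f = 0 ->
      f = 0 \/ f = galg_sum 'F_2 'D_(2 * p).
Proof.
move=> p_prime p_odd cardF two_m r_p r_cover.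
have chF : 2 \in [pchar F] := card_finPcharP cardF isT.
have [a [b [oa ob ab defG]]] := dihedral_generators (prime_gt1 p_prime).
have [K [iota _]] := countable_algebraic_closure F.
have chK : 2 \in [pchar K] by rewrite (fmorph_pchar iota).
have p1 : p%:R = 1 :> K.
  rewrite -(odd_double_half p) p_odd -muln2 natrD natrM.
  by rewrite (pcharf0 chK) mulr0 addr0.
have [z prim_z] : exists z : K, p.-primitive_root z.
  by apply: closed_prim_root_exists; rewrite ?p1 ?oner_eq0.
have zN0 n : z ^+ n != 0 by rewrite expf_neq0 // (prim_root_neq0 prim_z).
have /fin_all_exists[t tE] l : exists tl, iota tl = z ^+ r l + z ^- r l.
  apply: fixed_by_card_in_image; rewrite cardF.
  have -> : (z ^+ r l + z ^- r l) ^+ (2 ^ m)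
      = (z ^+ (2 ^ m)) ^+ r l + (z ^+ (2 ^ m)) ^- r l.
    have nat2m : [pchar K].-nat (2 ^ m)%N.
      by rewrite pnatX (eq_pnat _ (pcharf_eq chK)) pnat_id.
    by rewrite (exprDn_pchar _ _ nat2m) exprVn -!exprM mulnC.
  case/orP: two_m => two_m.
    have -> : z ^+ (2 ^ m) = z.
      by rewrite -[RHS]expr1; apply/eqP; rewrite (eq_prim_root_expr prim_z).
    by [].
  have -> : z ^+ (2 ^ m) = z^-1.
    have z_neq0 := prim_root_neq0 prim_z.
    apply: (mulIf z_neq0); rewrite mulVf //.
    by apply/eqP; rewrite -exprSr -addn1 -(prim_order_dvd prim_z).
  by rewrite exprVn invrK addrC.
have zz' l : z ^+ r l * z ^- r l = 1 by rewrite mulfV.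
have zp l : (z ^+ r l) ^+ p = 1.
  by rewrite exprAC (prim_expr_order prim_z) expr1n.
have /fin_all_exists[rho /all_and2[rho_a rho_b]] l :=
  dihedral_representation oa ob ab defG (zz' l) (tE l)
    (prim_root_neq_inv p_odd prim_z (r_p l)) (zp l).
pose kappa := F2_embedding chF.
pose phi l : {rmorphism group_algebra 'F_2 'D_(2 * p) -> 'M[F]_2} :=
  (galg_repr kappa (rho l) :
     {rmorphism group_algebra 'F_2 'D_(2 * p) -> 'M[F]_2.-1.+1}).
exists phi; split.
  exact: (galg_repr_sum oa ob defG p_odd kappa prim_z r_p tE rho_a rho_b).
exact: (galg_repr_kernel oa ob defG p_odd chK prim_z r_p tE r_cover
          rho_a rho_b).
Qed.

Lemma units_dihedral p m k (F : finFieldType)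
    (phi : 'I_k -> {rmorphism group_algebra 'F_2 'D_(2 * p) -> 'M[F]_2}) :
    (1 < p)%N -> #|F| = (2 ^ m)%N -> (2 * m * k = p.-1)%N ->
    (forall l, phi l (galg_sum 'F_2 'D_(2 * p)) = 0) ->
    (forall f, (forall l, phi l f = 0) -> augmentation f = 0 ->
      f = 0 \/ f = galg_sum 'F_2 'D_(2 * p)) ->
  ([set: {unit group_algebra 'F_2 'D_(2 * p)}] / galg_V 'D_(2 * p))%g
     \isog setXn (fun _ : 'I_k => 'GL_2[F]%g)
  /\ #|[set: {unit group_algebra 'F_2 'D_(2 * p)}]|
       = (2 * #|'GL_2[F]%g| ^ k)%N.
Proof.
move=> p_gt1 cardF mk phi_sum phi_ker.
have oD : #|{: 'D_(2 * p)}| = (2 * p)%N.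
  by rewrite -cardsT mul2n card_dihedral.
have even_D : ~~ odd #|{: 'D_(2 * p)}| by rewrite oD oddM.
have card_phi : (2 ^ #|{: 'D_(2 * p)}| = 4 * #|'M[F]_2| ^ k)%N.
  rewrite oD card_mx cardF -!expnM -[4%N]/(2 ^ 2)%N -expnD; congr (2 ^ _)%N.
  rewrite -(prednK (ltnW p_gt1)) -mk mulnS; congr (_ + _)%N.
  by rewrite !mulnA [(2 * 2 * m)%N]mulnC mulnA.
split; first exact: (units_mod_V even_D phi_ker phi_sum card_phi).
exact: (card_units even_D phi_ker phi_sum card_phi).
Qed.

(** * Residues that are powers of two up to sign *)

Section PrimeResidues.

Variable p : nat.
Hypothesis p_prime : prime p.

Lemma natr_Fp_eq0 n : (n%:R == 0 :> 'F_p) = (p %| n)%N.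
Proof. by rewrite (dvdn_pcharf (pchar_Fp p_prime)). Qed.

Lemma eq_natr_Fp i j : (i%:R == j%:R :> 'F_p) = (i == j %[mod p])%N.
Proof. by rewrite -val_eqE /= !val_Fp_nat. Qed.

Lemma card_units_Fp : #|[set: {unit 'F_p}]| = p.-1.
Proof. by rewrite card_finField_unit card_Fp. Qed.

(** When the order d of 2 is odd, -1 is not a power of 2; since -1 has order 2,
    prime to d, the product -2 then has order 2 * d. *)
Lemma order_neg_two d (two : {unit 'F_p}) : odd p ->
    FinRing.uval two = 2%:R -> #[two]%g = d -> odd d ->
  exists2 g : {unit 'F_p}, FinRing.uval g = - 2%:R & #[g]%g = (2 * d)%N.
Proof.
move=> p_odd two_val two_order odd_d.
have UN1 : (-1 : 'F_p) \is a GRing.unit by rewrite unitrN unitr1.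
pose neg1 : {unit 'F_p} := FinRing.unit 'F_p UN1.
have neg1_order : #[neg1]%g = 2.
  apply: nt_prime_order => //; first by apply/val_inj; rewrite /= mulrNN mulr1.
  apply/eqP=> /(congr1 val) /= /eqP; rewrite eq_sym -subr_eq0 opprK.
  by rewrite -[1 + 1]/(2%:R) natr_Fp_eq0 // gtnNdvd // odd_prime_gt2.
exists (neg1 * two)%g; first by rewrite FinRing.val_unitM /= two_val mulN1r.
rewrite orderM ?neg1_order ?two_order ?coprime2n //.
by apply/val_inj; rewrite /= mulrC.
Qed.

Section Generator.

Variables (m : nat) (g : {unit 'F_p}).
Hypothesis g_val : FinRing.uval g = 2%:R \/ FinRing.uval g = - 2%:R.
Hypothesis g_order : #[g]%g = (2 * m)%N.

Let k := (totient p %/ (2 * m))%N.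

Lemma order_mul_index : (2 * m * k = p.-1)%N.
Proof.
rewrite /k totient_prime // mulnC divnK // -g_order -card_units_Fp.
by rewrite order_dvdG ?inE.
Qed.

(** The square of 2 ^ m is g ^ (2 * m) = 1, whatever the sign in g. *)
Lemma expn2_mod : (2 ^ m == 1 %[mod p])%N || (p %| 2 ^ m + 1)%N.
Proof.
have: ((2 ^ m)%:R : 'F_p) ^+ 2 = 1.
  have g2 : FinRing.uval g ^+ 2 = 2%:R ^+ 2.
    by case: g_val => ->; rewrite ?sqrrN.
  have := congr1 FinRing.uval (expg_order g).
  rewrite g_order FinRing.val_unitX exprM g2 -exprM mulnC natrX => g1.
  by rewrite -exprM g1.
move/eqP; rewrite sqrf_eq1 => /orP[/eqP m1|m1]; apply/orP; [left|right].
  by rewrite -eq_natr_Fp m1.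
by rewrite -natr_Fp_eq0 natrD addr_eq0.
Qed.

Lemma signed_power_of_two i :
  exists s : bool, val (g ^+ i)%g = (-1) ^+ s * (2 ^ i)%:R :> 'F_p.
Proof.
rewrite FinRing.val_unitX /= natrX; case: g_val => ->.
  by exists false; rewrite mul1r.
by exists (odd i); rewrite signr_odd -exprNn.
Qed.

Lemma coset_representatives :
  exists r : 'I_k -> nat, (forall l, ~~ (p %| r l)%N) /\
    forall j, (0 < j < p)%N -> exists l i,
       (j == r l * 2 ^ i %[mod p])%N \/ (p %| j + r l * 2 ^ i)%N.
Proof.
pose X := rcosets <[g]> [set: {unit 'F_p}].
have cardX : #|X| = k.
  rewrite -[#|X|]/(#|setT : <[g]>|)%g -divgS ?subsetT // card_units_Fp.
  by rewrite -orderE g_order -totient_prime.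
pose rep (l : 'I_k) := repr (enum_val (cast_ord (esym cardX) l)).
exists (fun l => val (val (rep l))); split=> [l|j jp].
  rewrite -natr_Fp_eq0 natr_Zp -unitfE; exact: valP.
have Uj : (j%:R : 'F_p) \is a GRing.unit.
  by rewrite unitfE natr_Fp_eq0 gtnNdvd //; case/andP: jp.
pose u : {unit 'F_p} := FinRing.unit 'F_p Uj.
have uX : (<[g]> :* u)%g \in X by apply/rcosetsP; exists u; rewrite ?inE.
pose l := cast_ord cardX (enum_rank_in uX (<[g]> :* u)%g).
have : u \in (<[g]> :* rep l)%g.
  by rewrite /rep cast_ordK enum_rankK_in // rcoset_repr rcoset_refl.
case/rcosetP=> _ /cycleP[i ->] uE; exists l, i.
have [s gi] := signed_power_of_two i.
have jE : j%:R = (-1) ^+ s * (val (val (rep l)) * 2 ^ i)%:R :> 'F_p.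
  rewrite natrM natr_Zp mulrCA -gi -FinRing.val_unitM.
  by have := congr1 val uE; rewrite FinRing.val_unitM /= mulrC.
case: s jE {gi} => jE; [right | left].
  by rewrite -natr_Fp_eq0 natrD jE mulN1r addNr.
by rewrite -eq_natr_Fp jE mul1r.
Qed.

End Generator.

End PrimeResidues.

(** * The unit group *)

Lemma card_GL_2_exp2 (F : finFieldType) m : #|F| = (2 ^ m)%N ->
  #|'GL_2[F]%g| = ((2 ^ (2 * m) - 1) * (2 ^ (2 * m) - 2 ^ m))%N.
Proof.
move=> cardF; rewrite card_GL_2 cardF [(2 * m)%N]mulnC expnM.
set q := (2 ^ m)%N.
have -> : (q ^ 2 - 1 = q.-1 * q.+1)%N by rewrite (subn_sqr q 1) subn1 addn1.
have -> : (q ^ 2 - q = q * q.-1)%N by rewrite -subn1 mulnBr muln1 mulnn.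
by rewrite [RHS]mulnC -mulnn !mulnA.
Qed.

Lemma units_dihedral_generator p m (g : {unit 'F_p}) (F : finFieldType)
    (k := (totient p %/ (2 * m))%N) :
    prime p -> odd p ->
    FinRing.uval g = 2%:R \/ FinRing.uval g = - 2%:R -> #[g]%g = (2 * m)%N ->
    #|F| = (2 ^ m)%N ->
  ([set: {unit group_algebra 'F_2 'D_(2 * p)}] / galg_V 'D_(2 * p))%g
     \isog setXn (fun _ : 'I_k => 'GL_2[F]%g)
  /\ #|[set: {unit group_algebra 'F_2 'D_(2 * p)}]| =
      (2 * ((2 ^ (2 * m) - 1) * (2 ^ (2 * m) - 2 ^ m)) ^ k)%N.
Proof.
move=> p_prime p_odd g_val g_order cardF; rewrite -(card_GL_2_exp2 cardF).
have [r [r_p r_cover]] := coset_representatives p_prime g_val g_order.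
have two_m := expn2_mod p_prime g_val g_order.
have [phi [phi_sum phi_ker]] :=
  dihedral_representations p_prime p_odd cardF two_m r_p r_cover.
have mk := order_mul_index p_prime g_order.
exact: units_dihedral (prime_gt1 p_prime) cardF mk phi_sum phi_ker.
Qed.

(** Puts together an isomorphism statement for every field of order 2 ^ m and
    the cardinality it entails, which needs one such field to exist. *)
Lemma all_fields_of_card m (P : finFieldType -> Prop) (Q : Prop) : (0 < m)%N ->
    (forall F : finFieldType, #|F| = (2 ^ m)%N -> P F /\ Q) ->
  (forall F : finFieldType, #|F| = (2 ^ m)%N -> P F) /\ Q.
Proof.
move=> m_gt0 PQ; split=> [F /PQ[] // |].
by have [F _ /PQ[]] := pPrimePowerField (isT : prime 2) m_gt0.
Qed.

Lemma by_cases (c : bool) (P1 P2 : Prop) (n n1 n2 : nat) :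
    (~~ c -> P1 /\ n = n1) -> (c -> P2 /\ n = n2) ->
  (if ~~ c then P1 else P2) /\ n = (if ~~ c then n1 else n2).
Proof. by case: c => [_ | + _]; apply. Qed.

Theorem theorem1 (p : nat) (p_prime : prime p) (p_odd : odd p)
    (two : {unit 'F_p}) (two_val : FinRing.uval two = (2%:R : 'F_p)%R)
    (d : nat) (d_order : d = #[two]%g) :
  (if ~~ odd d then
     forall F : finFieldType, #|F| = (2 ^ (d %/ 2))%N ->
       ([set: {unit group_algebra 'F_2 'D_(2 * p)}] / galg_V 'D_(2 * p))%g
         \isog setXn (fun _ : 'I_(totient p %/ d) => 'GL_2[F]%g)
   else
     forall F : finFieldType, #|F| = (2 ^ d)%N ->
       ([set: {unit group_algebra 'F_2 'D_(2 * p)}] / galg_V 'D_(2 * p))%g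
         \isog setXn (fun _ : 'I_(totient p %/ (2 * d)) => 'GL_2[F]%g))
  /\
  #|[set: {unit group_algebra 'F_2 'D_(2 * p)}]| =
    (if ~~ odd d then
       2 * ((2 ^ d - 1) * (2 ^ d - 2 ^ (d %/ 2))) ^ (totient p %/ d)
     else
       2 * ((2 ^ (2 * d) - 1) * (2 ^ (2 * d) - 2 ^ d)) ^ (totient p %/ (2 * d)))%N.
Proof.
apply: by_cases => [even_d | odd_d].
  have dE : (2 * (d %/ 2))%N = d by rewrite mulnC divnK // dvdn2.
  have m_gt0 : (0 < d %/ 2)%N.
    by have := order_gt0 two; rewrite -d_order -{1}dE muln_gt0.
  have two_order : #[two]%g = (2 * (d %/ 2))%N by rewrite dE.
  apply: all_fields_of_card m_gt0 _ => F.
  have := units_dihedral_generator (F := F) p_prime p_odd (or_introl two_val)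
            two_order.
  by rewrite dE.
have [g g_val g_order] :=
  order_neg_two p_prime p_odd two_val (esym d_order) odd_d.
have d_gt0 : (0 < d)%N by rewrite d_order order_gt0.
apply: all_fields_of_card d_gt0 _ => F.
exact: units_dihedral_generator p_prime p_odd (or_intror g_val) g_order.
Qed.
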